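(* Let $X$ be a real normed linear space. Suppose that for all $x, y \in X \setminus \{0\}$, $x \perp_B y$ implies $x \perp_{SB} y$. Then $X$ is strictly convex.
   Context: $S_X = \{x \in X : \|x\| = 1\}$ and $B_X = \{x \in X : \|x\| \le 1\}$. $X$ is strictly convex iff every element of $S_X$ is an extreme point of $B_X$. For $x, y \in X$: $x \perp_B y$ (Birkhoff-James orthogonality) iff $\|x\| \le \|x + \lambda y\|$ for all scalars $\lambda$; $x \perp_{SB} y$ (strong Birkhoff-James orthogonality) iff $\|x\| < \|x + \lambda y\|$ for all scalars $\lambda \ne 0$. *)

(* Defs.v *)
From mathcomp Require Import all_boot all_order all_algebra.
From mathcomp Require Import classical_sets reals topology normedtype.

Set Implicit Arguments.
Unset Strict Implicit.
Unset Printing Implicit Defensive.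

Import Order.TTheory GRing.Theory Num.Theory.
Import numFieldNormedType.Exports.

Local Open Scope classical_set_scope.
Local Open Scope ring_scope.

Definition unit_sphere (R : realType) (X : normedModType R) : set X :=
  [set x | `|x| = 1].

Definition unit_ball (R : realType) (X : normedModType R) : set X :=
  [set x | `|x| <= 1].

Arguments unit_sphere {R} X.
Arguments unit_ball {R} X.

Definition extreme_point (R : realType) (X : lmodType R) (A : set X) (x : X) :
    Prop :=
  A x /\
  forall (y z : X) (t : R), A y -> A z -> 0 < t -> t < 1 ->
    x = t *: y + (1 - t) *: z -> y = x /\ z = x.

Definition strictly_convex (R : realType) (X : normedModType R) : Prop :=
  forall x : X, unit_sphere X x -> extreme_point (unit_ball X) x.

Arguments strictly_convex {R} X.

Definition bj_orthogonal (R : realType) (X : normedModType R) (x y : X) :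
    Prop :=
  forall lambda : R, `|x| <= `|x + lambda *: y|.

Definition strong_bj_orthogonal (R : realType) (X : normedModType R)
    (x y : X) : Prop :=
  forall lambda : R, lambda != 0 -> `|x| < `|x + lambda *: y|.

(* Main.v *)
Require Import Defs.
From mathcomp Require Import all_boot all_order all_algebra.
From mathcomp Require Import classical_sets reals topology normedtype.
Import Order.TTheory GRing.Theory Num.Theory.
Import numFieldNormedType.Exports.
Local Open Scope ring_scope.

(* If a unit vector x is interior to a segment [z, y] of the unit ball, then
   the convex function l |-> |x + l (y - z)| is at most 1 on both sides of 0 and
   equals 1 at 0, so 0 is a global minimum: x is Birkhoff-James orthogonal to
   y - z.  If y != z, strong orthogonality then gives |y| > 1. *)

(** The point [x] lies between [x + s d] and [x - l d] with weights proportional to [l] and [s]. The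
    triangle inequality bounds [(l + s)|x|] by [l|x| + s|x - l d|], and [l|x|] cancels. *)
Lemma norm_le_opposite_side {R : realType} {X : normedModType R} {x d : X}
    {s l : R} :
  0 < s -> 0 <= l -> `|x + s *: d| <= `|x| -> `|x| <= `|x - l *: d|.
Proof.
move=> s0 l0 le_x.
have xE : (l + s) *: x = l *: (x + s *: d) + s *: (x - l *: d).
  by rewrite scalerDl scalerDr scalerBr !scalerA (mulrC s l) addrACA subrr addr0.
have := ler_normD (l *: (x + s *: d)) (s *: (x - l *: d)).
rewrite -xE !normrZ (gtr0_norm s0) (ger0_norm l0) ger0_norm; last first.
  by rewrite addr_ge0 // ltW.
move=> le_sum; rewrite -(ler_pM2l s0) -(lerD2l (l * `|x|)) -mulrDl.
by apply: (le_trans le_sum); rewrite lerD2r ler_wpM2l.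
Qed.

Lemma bj_orthogonal_two_sided {R : realType} {X : normedModType R} {x d : X}
    {s t : R} :
  0 < s -> 0 < t -> `|x + s *: d| <= `|x| -> `|x - t *: d| <= `|x| ->
  bj_orthogonal x d.
Proof.
(* Each sign of [l] uses the bound from the other side: for [l >= 0] the one at [-t], with direction
   [-d]; for [l < 0] the one at [s]. *)
move=> s0 t0 le_s le_t l; case: (leP 0 l) => [l0|/ltW l0].
  by rewrite -[d]opprK scalerN; apply: (norm_le_opposite_side t0);
    rewrite ?scalerN.
rewrite -[l]opprK scaleNr.
by apply: (norm_le_opposite_side s0); rewrite ?oppr_ge0.
Qed.

Theorem theorem2p1 (R : realType) (X : normedModType R)
  (H : forall x y : X, x != 0 -> y != 0 ->
         bj_orthogonal x y -> strong_bj_orthogonal x y) :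
  strictly_convex X.
Proof.
move=> x; rewrite /unit_sphere /= => x1.
split=> [|y z t]; rewrite /unit_ball /=; first by rewrite x1.
move=> y1 z1 t0 t1 xE.
have s0 : 0 < 1 - t by rewrite subr_gt0.
(* Along [y - z], the endpoints sit at parameters [1 - t] and [-t]. *)
have yE : x + (1 - t) *: (y - z) = y.
  by rewrite xE -addrA -scalerDr (addrC z) subrK -scalerDl (addrC t) subrK scale1r.
have zE : x - t *: (y - z) = z.
  rewrite -[RHS](subKr y) -[X in _ = X - _]yE scalerBl scale1r -addrA.
  by rewrite [y - z - _ - _]addrAC subrr sub0r.
have [yz|yz] := eqVneq y z.
  by move: yE; rewrite yz subrr scaler0 addr0.
have d0 : y - z != 0 by rewrite subr_eq0.
have x0 : x != 0 by rewrite -normr_gt0 x1.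
have orth : bj_orthogonal x (y - z).
  by apply: (bj_orthogonal_two_sided s0 t0); rewrite ?yE ?zE x1.
(* The parameter [1 - t] lands exactly on [y]. *)
have := H _ _ x0 d0 orth _ (lt0r_neq0 s0).
by rewrite yE x1 ltNge y1.
Qed.
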